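(* For every integer $N\geq 3$, one has $\Phi(N) = \Upsilon(N^2-4)$.
   Context: Let $A = \begin{pmatrix} 1 & 0 \\ 1 & 1 \end{pmatrix}$ and $B = \begin{pmatrix} 1 & 1 \\ 0 & 1 \end{pmatrix}$, and let $\langle A,B\rangle \subset \mathrm{SL}_2(\mathbb{Z})$ denote the monoid generated by $A$ and $B$ (i.e. the set of all finite products of $A$'s and $B$'s). For an integer $N\geq 3$ define \[ \Phi(N) = \#\{\, C\in \langle A,B\rangle : \operatorname{tr} C = N \,\}, \] which is finite. Let $\mathbb{N}$ denote the set of positive integers and let $d(n)$ denote the number of positive divisors of the positive integer $n$. For a positive integer $X$ define \[ \Upsilon(X) = \sum_{\substack{ m\in\mathbb{Z},\ 0 \leq |m| < \sqrt{X} \\ m^2 \equiv X \bmod 4 }} d\left(\frac{X-m^2}{4}\right) = \#\{\, (\lambda,\mu,m)\in\mathbb{N}^2\times\mathbb{Z} : 4\lambda\mu + m^2 = X \,\}. \] *)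

(* Defs.v *)
From HB Require Import structures.
From mathcomp Require Import all_boot all_order all_algebra.
From mathcomp Require Import finmap.
From mathcomp Require Import boolp classical_sets functions cardinality fsbigop.

Set Implicit Arguments.
Unset Strict Implicit.
Unset Printing Implicit Defensive.

Import Order.TTheory GRing.Theory Num.Theory.
Local Open Scope classical_set_scope.
Local Open Scope ring_scope.

Definition mx2 (a b c d : int) : 'M[int]_2 :=
  \matrix_(i < 2, j < 2) nth 0 (nth [::] [:: [:: a; b]; [:: c; d]] i) j.

Definition matA : 'M[int]_2 := mx2 1 0 1 1.
Definition matB : 'M[int]_2 := mx2 1 1 0 1.

(* The empty product is allowed, so the identity belongs to the monoid. *)
Definition monoidAB : set 'M[int]_2 :=
  [set C | exists2 s : seq 'M[int]_2,
     {subset s <= [:: matA; matB]} & C = \prod_(M <- s) M].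

(* [fset_set] sends infinite sets to the empty one; the set below is finite
   when 3 <= N, but not for N = 2, since it then contains every power of matA. *)
Definition Phi (N : int) : nat :=
  #|` fset_set [set C | monoidAB C /\ \tr C = N] |.

Definition num_divisors (n : nat) : nat := size (divisors n).

(* For m in the range, |m| < sqrt X is written m ^+ 2 < X; the argument of
   num_divisors is then an exact, positive quotient, so that the absolute value
   is only a cast from int to nat. The range is finite, hence \sum_(m \in _) is
   a genuine sum. *)
Definition Upsilon (X : int) : nat :=
  \sum_(m \in [set m : int | m ^+ 2 < X /\ (m ^+ 2 = X %[mod 4])%Z])
     num_divisors `|((X - m ^+ 2) %/ 4)%Z|%N.

(* Main.v *)
Require Import Defs.
From mathcomp Require Import all_boot all_order all_algebra.
From mathcomp Require Import finmap zify.
From mathcomp Require Import classical_sets cardinality fsbigop.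

Import Order.TTheory GRing.Theory Num.Theory.
Local Open Scope ring_scope.

(** The monoid generated by [matA] and [matB] consists of all matrices of
determinant 1 with nonnegative entries ([monoidABP]): such a matrix other than
the identity has one row dominating the other, and subtracting the smaller row
amounts to splitting off a left factor [matA] or [matB].

Let C have rows (a, b) and (c, d), nonnegative entries, determinant 1 and trace
N, and put m := a - d. Then m ^ 2 = N ^ 2 - 4 a d, so that
4 b c + m ^ 2 = N ^ 2 - 4. When N >= 3 neither b nor c can vanish: b c = 0 would
give a d = 1, hence a = d = 1 and N = 2. Conversely, if b and c are positive and
4 b c + m ^ 2 = N ^ 2 - 4, then m has the parity of N and |m| < N, so that
a := (N + m) / 2 and d := (N - m) / 2 are nonnegative integers with
a d - b c = 1. Thus C corresponds to the pair (m, b), where b is a divisor of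
(N ^ 2 - 4 - m ^ 2) / 4 and c is the complementary divisor; [matrices_of_trace]
lists the matrices indexed by these pairs. *)

Lemma mx2E (C : 'M[int]_2) : C = mx2 (C 0 0) (C 0 1) (C 1 0) (C 1 1).
Proof.
apply/matrixP => i j; rewrite !mxE.
by case: i => -[|[|i]] //= hi; case: j => -[|[|j]] //= hj;
  congr (C _ _); apply/val_inj.
Qed.

Lemma mx2_mul (a b c d a' b' c' d' : int) :
  mx2 a b c d * mx2 a' b' c' d' =
  mx2 (a * a' + b * c') (a * b' + b * d') (c * a' + d * c') (c * b' + d * d').
Proof.
apply/matrixP => i j; rewrite !mxE big_ord_recl big_ord1 !mxE /=.
by case: i => -[|[|i]] //= hi; case: j => -[|[|j]] //= hj.
Qed.

Lemma det_mx2 (a b c d : int) : \det (mx2 a b c d) = a * d - b * c.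
Proof.
rewrite (expand_det_row _ 0) big_ord_recl big_ord1 /cofactor !det_mx11 !mxE /=.
by rewrite expr0 mul1r expr1 mulN1r mulrN.
Qed.

Lemma tr_mx2 (a b c d : int) : \tr (mx2 a b c d) = a + d.
Proof. by rewrite /mxtrace big_ord_recl big_ord1 !mxE. Qed.

Lemma mx2_inj (a b c d a' b' c' d' : int) :
  mx2 a b c d = mx2 a' b' c' d' -> [/\ a = a', b = b', c = c' & d = d'].
Proof.
move=> /matrixP e.
by split; [move: (e 0 0) | move: (e 0 1) | move: (e 1 0) | move: (e 1 1)];
  rewrite !mxE.
Qed.

Lemma mx2_1 : mx2 1 0 0 1 = 1.
Proof.
apply/matrixP => i j; rewrite !mxE.
by case: i => -[|[|i]] //= hi; case: j => -[|[|j]] //= hj.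
Qed.

Lemma mx2_ge0 (a b c d : int) :
  (forall i j, 0 <= mx2 a b c d i j) <->
  [/\ 0 <= a, 0 <= b, 0 <= c & 0 <= d].
Proof.
split=> [h|[ha hb hc hd] i j].
  by move: (h 0 0) (h 0 1) (h 1 0) (h 1 1); rewrite !mxE.
by rewrite !mxE; case: i => -[|[|i]] //= hi; case: j => -[|[|j]] //= hj.
Qed.

Lemma monoidAB_1 : monoidAB 1.
Proof. by exists [::]; rewrite ?big_nil. Qed.

Lemma monoidAB_mull (M C : 'M[int]_2) :
  M \in [:: matA; matB] -> monoidAB C -> monoidAB (M * C).
Proof.
move=> hM [s hs ->]; exists (M :: s); last by rewrite big_cons.
by move=> x; rewrite in_cons => /predU1P[->|/hs].
Qed.

Lemma monoidAB_ge0_det1 (C : 'M[int]_2) :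
  monoidAB C -> (forall i j, 0 <= C i j) /\ \det C = 1.
Proof.
move=> [s hs ->]; elim: s hs => [|M s IHs] hs.
  by rewrite big_nil det1 -mx2_1; split=> //; apply/mx2_ge0.
have [hs0 hs1] := IHs (fun x hx => hs x (mem_behead (s := M :: s) hx)).
have [hM0 hM1] : (forall i j, 0 <= M i j) /\ \det M = 1.
  have := hs M (mem_head _ _); rewrite !inE => /orP[] /eqP ->.
    by rewrite det_mx2; split=> //; apply/mx2_ge0.
  by rewrite det_mx2; split=> //; apply/mx2_ge0.
rewrite big_cons; split=> [i j|]; last by rewrite det_mulmx hM1 hs1.
by rewrite mxE; apply: sumr_ge0 => k _; apply: mulr_ge0.
Qed.

Lemma ge0_det1_monoidAB (a b c d : int) :
  0 <= a -> 0 <= b -> 0 <= c -> 0 <= d -> a * d - b * c = 1 ->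
  monoidAB (mx2 a b c d).
Proof.
(* The sum of the entries decreases when a row is subtracted from the other. *)
have [n] := ubnP `|(a + b + c + d)%R|%N.
elim: n a b c d => // n IHn a b c d hn ha hb hc hd hdet.
have : [\/ c <= a /\ d <= b, a <= c /\ b <= d | c < a /\ b < d].
  have [hac|hac] := lerP a c; have [hbd|hbd] := lerP b d.
  - by constructor 2.
  - by exfalso; nia.
  - by have [e|?] := eqVneq b d; [constructor 1|constructor 3]; lia.
  - by constructor 1; lia.
move=> [[hac hbd]|[hac hbd]|[hac hbd]].
- have -> : mx2 a b c d = matB * mx2 (a - c) (b - d) c d.
    by rewrite mx2_mul !mul1r !mul0r !add0r !subrK.
  apply: monoidAB_mull; first by rewrite !inE eqxx orbT.
  have cd_gt0 : 0 < c + d by nia.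
  by apply: IHn; lia.
- have -> : mx2 a b c d = matA * mx2 a b (c - a) (d - b).
    by rewrite mx2_mul !mul1r !mul0r !addr0 ![_ + (_ - _)]addrC !subrK.
  apply: monoidAB_mull; first by rewrite !inE eqxx.
  have ab_gt0 : 0 < a + b by nia.
  by apply: IHn; lia.
- (* 1 = a d - b c >= (c + 1) (b + 1) - b c = b + c + 1 forces b = c = 0. *)
  have had : (c + 1) * (b + 1) <= a * d by apply: ler_pM; lia.
  have [b0 c0] : b = 0 /\ c = 0 by split; lia.
  have [-> ->] : a = 1 /\ d = 1 by split; nia.
  by rewrite b0 c0 mx2_1; exact: monoidAB_1.
Qed.

Lemma monoidABP (C : 'M[int]_2) :
  monoidAB C <-> (forall i j, 0 <= C i j) /\ \det C = 1.
Proof.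
split; first exact: monoidAB_ge0_det1.
rewrite (mx2E C) det_mx2 => -[/mx2_ge0[ha hb hc hd] hdet].
exact: ge0_det1_monoidAB.
Qed.

(** The integers m with m ^ 2 < X and m ^ 2 congruent to X modulo 4, as a
duplicate-free sequence. The scan of [- X, X) misses none of them, since
|m| <= m ^ 2 < X. *)
Definition sqr_lt_eqmod4 (X : int) : seq int :=
  [seq m <- [seq i%:Z - X | i <- iota 0 `|(2 * X)%R|%N] |
    (m ^+ 2 < X) && (m ^+ 2 == X %[mod 4])%Z].

Lemma sqr_lt_eqmod4_uniq (X : int) : uniq (sqr_lt_eqmod4 X).
Proof.
rewrite filter_uniq // map_inj_uniq ?iota_uniq // => i j.
by move=> /addIr [].
Qed.

Lemma mem_sqr_lt_eqmod4 (X m : int) :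
  (m \in sqr_lt_eqmod4 X) = (m ^+ 2 < X) && (m ^+ 2 == X %[mod 4])%Z.
Proof.
rewrite mem_filter andb_idr // => /andP[hm _].
apply/mapP; exists `|(m + X)%R|%N; last by nia.
by rewrite mem_iota; nia.
Qed.

(** The quotient (X - m ^ 2) / 4 as a natural number; it is exact and positive
for m in [sqr_lt_eqmod4 X], by [quarter_gapP]. *)
Definition quarter_gap (X m : int) : nat := `|((X - m ^+ 2) %/ 4)%Z|%N.

Lemma quarter_gapP (X m : int) :
  m \in sqr_lt_eqmod4 X ->
  (0 < quarter_gap X m)%N /\ 4 * (quarter_gap X m)%:Z + m ^+ 2 = X.
Proof.
rewrite mem_sqr_lt_eqmod4 eq_sym eqz_mod_dvd => /andP[hm /divzK].
by rewrite /quarter_gap; lia.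
Qed.

(** The matrix of trace N, determinant 1 and diagonal difference m with
upper-right entry b, for m in [sqr_lt_eqmod4 (N ^+ 2 - 4)] and b dividing
(N ^ 2 - 4 - m ^ 2) / 4. *)
Definition matrix_of (N m : int) (b : nat) : 'M[int]_2 :=
  mx2 ((N + m) %/ 2)%Z b%:Z
      (quarter_gap (N ^+ 2 - 4) m %/ b)%N%:Z ((N - m) %/ 2)%Z.

(** The matrices of the monoid with trace N, when N >= 3
([mem_matrices_of_trace]). *)
Definition matrices_of_trace (N : int) : seq 'M[int]_2 :=
  [seq matrix_of N m b | m <- sqr_lt_eqmod4 (N ^+ 2 - 4),
                         b <- divisors (quarter_gap (N ^+ 2 - 4) m)].

(** Both halves are exact: m has the parity of N. *)
Lemma half_sum_diff (N m : int) : m \in sqr_lt_eqmod4 (N ^+ 2 - 4) ->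
  [/\ 2 * ((N + m) %/ 2)%Z = N + m & 2 * ((N - m) %/ 2)%Z = N - m].
Proof.
move=> /quarter_gapP[_]; set k := quarter_gap _ _ => hk.
have he : exists q, N + m = 2 * q.
  exists ((N + m) %/ 2)%Z.
  have hr : ((N + m) %% 2)%Z = 0 \/ ((N + m) %% 2)%Z = 1 by lia.
  have := divz_eq (N + m) 2; move: (_ %/ _)%Z => q.
  by case: hr => -> hq; [lia|exfalso; nia].
by case: he => q hq; split; lia.
Qed.

Lemma matrices_of_trace_uniq (N : int) : uniq (matrices_of_trace N).
Proof.
apply: allpairs_uniq_dep => [|m _|].
- exact: sqr_lt_eqmod4_uniq.
- exact: divisors_uniq.
move=> u v /allpairsPdep[m [b [hm _ ->]]] /allpairsPdep[m' [b' [hm' _ ->]]] /=.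
move=> /mx2_inj[ea [eb] _ _].
(* The upper-left entries give N + m = N + m', as the halves are exact. *)
have [h _] := half_sum_diff _ _ hm; have [h' _] := half_sum_diff _ _ hm'.
have em : m = m' by lia.
by rewrite em eb.
Qed.

Lemma mem_matrices_of_trace (N : int) (C : 'M[int]_2) : 3 <= N ->
  C \in matrices_of_trace N <-> monoidAB C /\ \tr C = N.
Proof.
move=> hN; rewrite monoidABP; split.
  move=> /allpairsPdep[m [b [hm]]].
  have [hk0 hk] := quarter_gapP _ _ hm; have [h1 h2] := half_sum_diff _ _ hm.
  rewrite -dvdn_divisors // => /divnK hb ->.
  rewrite /matrix_of det_mx2 tr_mx2 mx2_ge0.
  move: hb hk hk0 h1 h2; set k := quarter_gap _ _; set c := (k %/ b)%N.
  move: c => c; move: k (_ %/ _)%Z (_ %/ _)%Z => k a d hb hk hk0 h1 h2.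
  have hmN : m ^+ 2 < N ^+ 2 by lia.
  by split; [split; [split; nia|nia]|lia].
rewrite (mx2E C) det_mx2 tr_mx2 mx2_ge0.
move: (C 0 0) (C 0 1) (C 1 0) (C 1 1) => a b c d [[[ha hb hc hd] hdet] htr].
have bc_neq0 : b * c != 0.
  apply/eqP => bc0; have ad1 : a * d = 1 by lia.
  have [a_gt0 d_gt0] : 0 < a /\ 0 < d by split; nia.
  (* (a - 1) (d - 1) = 2 - N would be negative. *)
  by nia.
have [b0 c0] : 0 < b /\ 0 < c.
  by move: bc_neq0; rewrite mulf_eq0 negb_or !lt_neqAle ![0 == _]eq_sym
    hb hc !andbT => /andP[].
pose X := N ^+ 2 - 4; have hX : X - (a - d) ^+ 2 = 4 * (b * c) by rewrite /X; nia.
have hm : a - d \in sqr_lt_eqmod4 X.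
  rewrite mem_sqr_lt_eqmod4 eq_sym eqz_mod_dvd hX dvdz_mulr ?dvdzz // andbT.
  by nia.
have hk : quarter_gap X (a - d) = (`|b| * `|c|)%N.
  by have [_] := quarter_gapP _ _ hm; nia.
apply/allpairsPdep; exists (a - d), `|b|%N; split=> //.
  by rewrite hk -dvdn_divisors ?dvdn_mulr //; lia.
rewrite /matrix_of -/X hk mulKn; last by lia.
by congr mx2; lia.
Qed.

Theorem theorem2 (N : int) (hN : 3 <= N) : Phi N = Upsilon (N ^+ 2 - 4).
Proof.
have -> : Phi N = size (matrices_of_trace N).
  rewrite /Phi (_ : [set C | _]%classic =
                    [set` [fset C in matrices_of_trace N]%fset]%classic).
    by rewrite set_fsetK card_fseq undup_id // matrices_of_trace_uniq.
  by apply/seteqP; split=> C /=; rewrite inE => /(mem_matrices_of_trace _ _ hN).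
rewrite /Upsilon (_ : [set m | _]%classic =
                      [set` sqr_lt_eqmod4 (N ^+ 2 - 4)]%classic).
  rewrite -fsbig_seq ?sqr_lt_eqmod4_uniq // size_allpairs_dep sumnE big_map.
  by [].
apply/seteqP; split=> m /=; rewrite mem_sqr_lt_eqmod4.
  by move=> [-> /eqP ->].
by move=> /andP[-> /eqP ->].
Qed.
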